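(* Let $H$ be a bipartite graph with $n$ vertices such that every vertex in one part has degree at most $k$ and every vertex in the other part has degree at most $\Delta$. If $G$ is a bipartite graph with edge density $\epsilon$ and at least $16\Delta^{1/k}\epsilon^{-k}n$ vertices in each part, then $H$ is a subgraph of $G$.
   Context: The edge density of a bipartite graph with parts $A,B$ is $e(A,B)/(|A||B|)$. *)

(* Defs.v *)
From mathcomp Require Import all_boot all_order all_algebra.
From mathcomp Require Import reals exp.

Set Implicit Arguments.
Unset Strict Implicit.
Unset Printing Implicit Defensive.

Import GRing.Theory Num.Theory.
Local Open Scope ring_scope.

Record sgraph := SGraph {
  vertex :> finType;
  adj : rel vertex;
  adj_sym : symmetric adj;
  adj_irr : irreflexive adj
}.

Definition degree (G : sgraph) (x : G) : nat := #|[set y : G | adj x y]|.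

Definition independent (G : sgraph) (A : {set G}) : Prop :=
  {in A &, forall x y : G, ~~ adj x y}.

Definition bipartition (G : sgraph) (A B : {set G}) : Prop :=
  [/\ A :|: B = [set: G], [disjoint A & B], independent A & independent B].

(* Ordered pairs, with A and B disjoint: each edge between A and B is counted
   once. *)
Definition edges_between (G : sgraph) (A B : {set G}) : nat :=
  #|[set p : G * G | [&& p.1 \in A, p.2 \in B & adj p.1 p.2]]|.

Definition edge_density (R : realType) (G : sgraph) (A B : {set G}) : R :=
  (edges_between A B)%:R / (#|A|%:R * #|B|%:R).

(* H is isomorphic to a not necessarily induced subgraph of G; the copy need
   not respect chosen bipartitions. *)
Definition is_subgraph (H G : sgraph) : Prop :=
  exists f : H -> G,
    injective f /\ forall x y : H, adj x y -> adj (f x) (f y).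

(* Main.v *)
Require Import Defs.
From mathcomp Require Import all_boot all_order all_algebra.
From mathcomp Require Import reals exp.
From mathcomp Require Import ring lra zify.

Set Implicit Arguments.
Unset Strict Implicit.
Unset Printing Implicit Defensive.

Import Order.TTheory GRing.Theory Num.Theory.
Local Open Scope ring_scope.

(** Dependent random choice with potentials. Write d(S) for the number of common
    neighbours in B of a k-tuple S of A, and call S scarce with weight
    1/(d(S)+1) if d(S) < n, and 0 otherwise. If A' is the common neighbourhood
    of k random vertices of B, then S lies in A' with probability (d(S)/|B|)^k,
    so the expected total weight of the k-tuples of A' is at most
    |A|^k n^(k-1) / |B|^k, while E |A'|^k >= (eps^k |A|)^k by convexity. Some A'
    is therefore large with small average weight. Embed the side of H of degree
    at most Delta injectively into A' by the method of conditional expectations: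
    as at least half of A' is always free, each neighbourhood costs at most a
    factor 2^k. The weights of the images of the at most Delta n nonempty
    neighbourhoods then sum to less than 1, which forces at most d of them to
    have at most d common neighbours, for each d < n; the other side of H can
    thus be placed greedily in B. *)

(** * Convexity and averaging inequalities *)

Section PowerMean.
Variable R : realFieldType.

(** Induction on [m]: multiplying the tangent bound by [x] gives the next tangent bound plus exactly
    [m.+1%:R * c ^+ m * (x - c) ^+ 2]. *)
Lemma exp_tangent (x c : R) (m : nat) : 0 <= x -> 0 <= c ->
  c ^+ m.+1 + m.+1%:R * c ^+ m * (x - c) <= x ^+ m.+1.
Proof.
move=> x0 c0; elim: m => [|m IHm]; first by rewrite !expr1 expr0; lra.
rewrite [leRHS]exprS; apply: le_trans (ler_wpM2l x0 IHm).
have h : 0 <= m.+1%:R * c ^+ m * (x - c) ^+ 2.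
  by rewrite mulr_ge0 ?sqr_ge0 ?mulr_ge0 ?ler0n ?exprn_ge0.
rewrite -subr_ge0 (le_trans h) // le_eqVlt; apply/orP; left; apply/eqP.
have -> : m.+2%:R = m.+1%:R + 1 :> R by rewrite natr1.
by rewrite (exprS c m.+1) (exprS c m); ring.
Qed.

(** Jensen's inequality for powers: summing the tangent bounds at the mean [c], the linear terms
    cancel. *)
Lemma power_mean (I : finType) (x : I -> R) (m : nat) :
  (forall i, 0 <= x i) -> (0 < #|I|)%N ->
  #|I|%:R * ((\sum_i x i) / #|I|%:R) ^+ m <= \sum_i x i ^+ m.
Proof.
move=> x0 I0; case: m => [|m].
  by rewrite expr0 mulr1 (eq_bigr (fun=> 1)) // sumr_const.
set c := _ / _.
have c0 : 0 <= c by rewrite divr_ge0 ?ler0n ?sumr_ge0.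
apply: (@le_trans _ _ (\sum_i (c ^+ m.+1 + m.+1%:R * c ^+ m * (x i - c))));
  last by apply: ler_sum => i _; exact: exp_tangent.
rewrite big_split /= sumr_const -mulr_sumr sumrB sumr_const.
have -> : \sum_i x i - c *+ #|I| = 0.
  by rewrite -mulr_natr /c divfK ?subrr // pnatr_eq0 -lt0n.
by rewrite mulr0 addr0 mulr_natl.
Qed.

Lemma exists_le_of_sum (I : finType) (P : pred I) (F G : I -> R) :
  (exists i, P i) -> \sum_(i | P i) F i <= \sum_(i | P i) G i ->
  exists2 i, P i & F i <= G i.
Proof.
move=> [i0 Pi0] h.
case: (boolP [exists i, P i && (F i <= G i)]) => [/existsP[i /andP[]]|].
  by exists i.
rewrite negb_exists => /forallP /= n.
move: h; rewrite leNgt; suff -> : \sum_(i | P i) G i < \sum_(i | P i) F i by [].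
apply: ltr_sum; first by apply/hasP; exists i0; rewrite ?mem_index_enum.
by move=> i Pi; move: (n i); rewrite Pi /= -ltNge.
Qed.

End PowerMean.

(** * Dependent random choice *)

Section DependentRandomChoice.
Variables (R : realFieldType) (U W : finType) (e : U -> W -> bool).

Definition common_nbhd (I : finType) (S : I -> U) : {set W} :=
  [set w | [forall i, e (S i) w]].

(* The weight 1/(d+1) is chosen so that [d+1] sets of size at most [d < n]
   already have total weight at least 1. *)
Definition scarcity (n d : nat) : R := if (d < n)%N then d.+1%:R^-1 else 0.

Lemma scarcity_ge0 n d : 0 <= scarcity n d.
Proof. by rewrite /scarcity; case: ifP; rewrite ?invr_ge0 ?ler0n. Qed.

Lemma scarcity_antitone n d d' : (d <= d')%N -> scarcity n d' <= scarcity n d.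
Proof.
move=> dd'; rewrite /scarcity; case: (ltnP d' n) => h.
  by rewrite (leq_ltn_trans dd' h) lef_pV2 ?posrE ?ltr0n // ler_nat ltnS.
exact: (scarcity_ge0 n d).
Qed.

(** One factor [d] is absorbed by the weight [1/(d+1)] and the others are below [n]; this saves a
    factor [n] in the expected weight. *)
Lemma scarcity_mul_exp n d m : scarcity n d * d%:R ^+ m.+1 <= n%:R ^+ m.
Proof.
rewrite /scarcity; case: ltnP => h; last by rewrite mul0r exprn_ge0 ?ler0n.
rewrite mulrC ler_pdivrMr ?ltr0n // exprSr ler_pM ?exprn_ge0 ?ler0n //.
  by rewrite lerXn2r ?nnegrE ?ler0n // ler_nat ltnW.
by rewrite ler_nat.
Qed.

(** The set [A] is the common neighbourhood of a tuple of [m.+1] elements of [W]. Expectations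
    become sums over all tuples, and both bounds are cleared of denominators. *)
Lemma dependent_random_choice (m n : nat) (eps : R) :
  (0 < n)%N -> (0 < #|U|)%N -> (0 < #|W|)%N -> 0 < eps ->
  eps * (#|U|%:R * #|W|%:R) <= (\sum_u #|[set w | e u w]|)%:R ->
  exists A : {set U},
    (eps ^+ m.+1 * #|U|%:R) ^+ m.+1 <= 2 * #|A|%:R ^+ m.+1 /\
    (\sum_(S : {ffun 'I_m.+1 -> U} | S \in ffun_on A)
        scarcity n #|common_nbhd S|) * (eps ^+ m.+1 * #|W|%:R) ^+ m.+1
      <= 2 * n%:R ^+ m * #|A|%:R ^+ m.+1.
Proof.
move=> n0 U0 W0 e0 he.
pose nb (T : {ffun 'I_m.+1 -> W}) := [set u | [forall j, e u (T j)]].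
pose a : R := #|U|%:R; pose b : R := #|W|%:R.
have a0 : 0 < a by rewrite ltr0n.
have b0 : 0 < b by rewrite ltr0n.
pose L := (eps ^+ m.+1 * a) ^+ m.+1.
have L0 : 0 < L by rewrite exprn_gt0 // mulr_gt0 // exprn_gt0.
pose M : R := a ^+ m.+1 * n%:R ^+ m.
have M0 : 0 < M by rewrite mulr_gt0 ?exprn_gt0 ?ltr0n.
pose Y (A : {set U}) : R := \sum_(S : {ffun 'I_m.+1 -> U} | S \in ffun_on A)
        scarcity n #|common_nbhd S|.
have Y0 A : 0 <= Y A by rewrite sumr_ge0 // => S _; exact: scarcity_ge0.
have cardT : #|{ffun 'I_m.+1 -> W}|%:R = b ^+ m.+1 :> R.
  by rewrite card_ffun card_ord natrX.
(* Double counting: [u] lies in [nb T] for exactly [deg(u) ^ m.+1] tuples [T], and the mean of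
   [deg(u)] is at least [eps * b]. *)
have sumnb : a * (eps * b) ^+ m.+1 <= \sum_T #|nb T|%:R.
  have -> : \sum_T #|nb T|%:R = \sum_u #|[set w | e u w]|%:R ^+ m.+1 :> R.
    rewrite -natr_sum.
    under eq_bigr => T _ do rewrite -sum1_card big_mkcond /=.
    rewrite exchange_big /= natr_sum; apply: eq_bigr => u _.
    rewrite -big_mkcond /= sum1_card -natrX; congr (_%:R).
    rewrite -[X in (_ ^ X)%N](card_ord m.+1) -card_ffun_on.
    apply: eq_card => T; change ((u \in nb T) = (T \in ffun_on [set w | e u w])).
    rewrite inE; apply/forallP/ffun_onP => h j; by move: (h j); rewrite ?inE.
  apply: le_trans (power_mean m.+1 (x := fun u => #|[set w | e u w]|%:R) _ U0);
    last by move=> u; exact: ler0n.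
  rewrite ler_wpM2l ?(ltW a0) // lerXn2r ?nnegrE //.
  - by rewrite mulr_ge0 // ltW.
  - by rewrite divr_ge0 ?ler0n // sumr_ge0.
  - by rewrite ler_pdivlMr // -natr_sum -mulrA (mulrC b).
have sumX : b ^+ m.+1 * L <= \sum_T #|nb T|%:R ^+ m.+1.
  have T0 : (0 < #|{ffun 'I_m.+1 -> W}|)%N by rewrite card_ffun expn_gt0 W0.
  apply: le_trans (power_mean m.+1 (x := fun T => #|nb T|%:R) _ T0);
    last by move=> T; exact: ler0n.
  rewrite cardT ler_wpM2l ?exprn_ge0 ?(ltW b0) // lerXn2r ?nnegrE //.
  - by rewrite mulr_ge0 ?exprn_ge0 // ltW.
  - by rewrite divr_ge0 ?exprn_ge0 ?sumr_ge0 ?(ltW b0).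
  - rewrite ler_pdivlMr ?exprn_gt0 //; apply: le_trans sumnb.
    by rewrite exprMn mulrC mulrA (mulrC _ a) (mulrC _ (eps ^+ _)) mulrA lexx.
(* The entries of [S] lie in [nb T] exactly when those of [T] lie in [common_nbhd S], so [S] is
   counted [#|common_nbhd S| ^ m.+1] times. *)
have sumY : \sum_T Y (nb T) <= M.
  rewrite /Y (eq_bigr (fun T => \sum_(S : {ffun 'I_m.+1 -> U})
      if S \in ffun_on (nb T) then scarcity n #|common_nbhd S| else 0));
    last by move=> T _; rewrite big_mkcond.
  rewrite exchange_big /=.
  apply: (@le_trans _ _ (\sum_(S : {ffun 'I_m.+1 -> U}) n%:R ^+ m)); last first.
    by rewrite sumr_const card_ffun card_ord -[leLHS]mulr_natl natrX.
  apply: ler_sum => S _.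
  apply: le_trans (scarcity_mul_exp n #|common_nbhd S| m).
  rewrite -big_mkcond /= sumr_const -[leLHS]mulr_natr -natrX.
  rewrite -[X in (_ ^ X)%N](card_ord m.+1) -card_ffun_on.
  rewrite le_eqVlt; apply/orP; left; apply/eqP; congr (_ * _%:R).
  apply: eq_card => T; rewrite unfold_in; apply/ffun_onP/ffun_onP => h j.
    by rewrite inE; apply/forallP => i; move: (h i); rewrite inE => /forallP.
  by rewrite inE; apply/forallP => i; move: (h i); rewrite inE => /forallP.
have q0 : 0 <= b ^+ m.+1 * L / (2 * M).
  by apply/ltW/divr_gt0; apply: mulr_gt0 => //; apply: exprn_gt0.
have [w0 _] : exists w : W, w \in W by move: W0 => /card_gt0P.
(* The coefficient of [Y] makes the second term average to at most [L / 2]. Both terms being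
   nonnegative, each is then bounded by the right-hand side, which yields the two conclusions. *)
have [T _ hT] : exists2 T, true &
    L / 2 + b ^+ m.+1 * L / (2 * M) * Y (nb T) <= #|nb T|%:R ^+ m.+1.
  apply: exists_le_of_sum; first by exists [ffun=> w0].
  rewrite big_split /= sumr_const -mulr_sumr -[_ *+ _]mulr_natl cardT.
  apply: le_trans sumX.
  have : b ^+ m.+1 * L / (2 * M) * (\sum_T Y (nb T)) <= b ^+ m.+1 * L / (2 * M) * M.
    exact: ler_wpM2l.
  have -> : b ^+ m.+1 * L / (2 * M) * M = b ^+ m.+1 * L / 2 by field; rewrite gt_eqF.
  lra.
have c0 : 0 <= b ^+ m.+1 * L / (2 * M) * Y (nb T).
  exact: mulr_ge0.
exists (nb T); rewrite -/L -/b -/(Y _); split; first by lra.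
have : b ^+ m.+1 * L / (2 * M) * Y (nb T) <= #|nb T|%:R ^+ m.+1 by lra.
have -> : b ^+ m.+1 * L / (2 * M) * Y (nb T) =
   (Y (nb T) * (eps ^+ m.+1 * b) ^+ m.+1) / (2 * n%:R ^+ m).
  rewrite /L /M !exprMn; field.
  by rewrite !lt0r_neq0 ?exprn_gt0 ?ltr0n.
rewrite ler_pdivrMr ?mulr_gt0 ?exprn_gt0 ?ltr0n // => h.
by rewrite (le_trans h) // mulrC.
Qed.

End DependentRandomChoice.

(** * Distinct representatives from small total scarcity *)

(** Greedy choice in which the element of [D] with the most candidates is served last. *)
Lemma greedy_sdr (R : realFieldType) (P W : finType) (N : P -> {set W})
    (n : nat) :
  (#|P| <= n)%N -> (0 < #|W|)%N -> \sum_p scarcity R n #|N p| < 1 ->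
  exists g : P -> W, injective g /\ forall p, g p \in N p.
Proof.
move=> Pn /card_gt0P[w0 _] small.
suff H j (D : {set P}) : #|D| = j -> exists g : P -> W,
    {in D &, injective g} /\ {in D, forall p, g p \in N p}.
  have [g [ginj gN]] := H _ [set: P] erefl.
  by exists g; split=> [p q|p]; [apply: ginj | apply: gN]; rewrite inE.
elim: j D => [|j IHj] D cD.
  by exists (fun=> w0); split=> p; rewrite (cards0_eq cD) inE.
have [p0 p0D] : exists p, p \in D by apply/card_gt0P; rewrite cD.
case: (arg_maxnP (fun p => #|N p|) p0D) => p pD' pmax.
have pD : p \in D := pD'.
have cDp : #|D :\ p| = j by move: (cardsD1 p D); rewrite cD pD => -[].
have [g [ginj gN]] := IHj _ cDp.
(* Otherwise all [j.+1] members of [D] have at most [j] candidates, and their weights, each at least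
   [1/(j+1)], reach 1. Here [j < n] keeps these weights from vanishing. *)
have jN : (j < #|N p|)%N.
  have jn : (j < n)%N by rewrite -cD (leq_trans (max_card _) Pn).
  rewrite ltnNge; apply/negP => Nj; move: small; rewrite ltNge => /negP; apply.
  rewrite (bigID (mem D)) /= -[leLHS]addr0 lerD ?sumr_ge0 //; last first.
    by move=> q _; exact: scarcity_ge0.
  apply: (@le_trans _ _ (\sum_(q in D) scarcity R n #|N p|)); last first.
    by apply: ler_sum => q qD; apply: scarcity_antitone; exact: pmax.
  rewrite sumr_const cD /scarcity (leq_ltn_trans Nj jn) -[leRHS]mulr_natl.
  by rewrite ler_pdivlMr ?ltr0n // mul1r ler_nat ltnS.
have [w wN wg] : exists2 w, w \in N p & w \notin g @: (D :\ p).
  apply/subsetPn; apply/negP => /subset_leq_card.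
  by rewrite leqNgt (leq_ltn_trans (leq_imset_card _ _)) // cDp.
exists (fun q => if q == p then w else g q); split=> [q q' qD q'D|q qD]; last first.
  by case: eqP => [->//|/eqP qp]; apply: gN; rewrite !inE qp.
case: eqP => [->|/eqP qp]; case: eqP => [->|/eqP q'p] //.
- by move=> E; case/negP: wg; rewrite E imset_f // !inE q'p.
- by move=> E; case/negP: wg; rewrite -E imset_f // !inE qp.
- by apply: ginj; rewrite !inE ?qp ?q'p.
Qed.

(** * Injective placement by conditional expectations *)

Section InjectiveEmbedding.
Variables (R : realFieldType) (Q U : finType) (k : nat) (A : {set U}).

Section Slots.
(* [s] lists the neighbours of one fixed vertex in the [k] coordinates of a
   tuple; [None] marks the coordinates in excess of its degree. *)
Variables (s : 'I_k -> option Q) (h : {ffun 'I_k -> U} -> R).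
Hypothesis s_inj : forall i j q, s i = Some q -> s j = Some q -> i = j.
Hypothesis h_ge0 : forall S, 0 <= h S.

Definition filled (D : {set Q}) : {set 'I_k} :=
  [set i | if s i is Some q then q \in D else false].

Definition consistent (D : {set Q}) (f : Q -> U) (S : {ffun 'I_k -> U}) :=
  (S \in ffun_on A) &&
  [forall i, if s i is Some q then (q \in D) ==> (S i == f q) else true].

(* Up to the factor [(#|A| / 2) ^+ k], an upper estimate of the conditional
   expectation of [h] once the vertices of [D] have been placed by [f]: a free
   vertex is drawn among at least [#|A| / 2] elements of [A]. *)
Definition potential (D : {set Q}) (f : Q -> U) : R :=
  (#|A|%:R / 2) ^+ #|filled D| * \sum_(S | consistent D f S) h S.

Definition assign (f : Q -> U) (q : Q) (a : U) : Q -> U :=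
  fun x => if x == q then a else f x.

(** If [q] fills a slot, that slot is unique, and the choices of [a] select disjoint families among
    the tuples consistent with [D]; the new factor [#|A| / 2] is at most [#|C|]. If [q] fills no
    slot, the potential is unchanged. *)
Lemma potential_assign (D : {set Q}) (f : Q -> U) (q : Q) (C : {set U}) :
  q \notin D -> C \subset A -> #|A|%:R / 2 <= #|C|%:R :> R ->
  \sum_(a in C) potential (q |: D) (assign f q a) <= #|C|%:R * potential D f.
Proof.
move=> qD CA hC.
have asgD a x : x \in D -> assign f q a x = f x.
  by rewrite /assign; case: eqP => // ->; rewrite (negPf qD).
case: (boolP [exists i, s i == Some q]) => [/existsP[i0 /eqP si0]|].
  have cf : #|filled (q |: D)| = #|filled D|.+1.
    have -> : filled (q |: D) = i0 |: filled D.
      apply/setP => i; rewrite !inE; case si: (s i) => [x|]; last first.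
        by case: eqP => // E; move: si; rewrite E si0.
      rewrite !inE; congr (_ || _); apply/eqP/eqP => [E|E].
        by apply: (s_inj (q := q)); rewrite // si E.
      by move: si; rewrite E si0 => -[].
    by rewrite cardsU1 inE si0 qD.
  have consE a S : consistent (q |: D) (assign f q a) S
      = consistent D f S && (S i0 == a).
    rewrite /consistent -andbA; congr (_ && _).
    apply/forallP/andP => [H|[/forallP H /eqP Sa] i].
      split; last by move: (H i0); rewrite si0 !inE eqxx /= /assign eqxx.
      apply/forallP => i; move: (H i); case: (s i) => // x; rewrite !inE.
      by case: (boolP (x \in D)) => // xD; rewrite orbT asgD.
    move: (H i); case si: (s i) => [x|//]; rewrite !inE.
    case: (eqVneq x q) => [E|xq] /=; last first.
      by rewrite /assign (negPf xq).
    have ii : i = i0 by apply: (s_inj (q := q)); rewrite // si E.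
    by rewrite /assign E eqxx ii Sa eqxx.
  rewrite /potential cf -mulr_sumr; set X := #|A|%:R / 2.
  rewrite exprS -(mulrA X); have X0 : 0 <= X by rewrite divr_ge0 ?ler0n.
  apply: ler_pM => //.
    by rewrite mulr_ge0 ?exprn_ge0 ?sumr_ge0 // => a _; rewrite sumr_ge0.
  rewrite ler_wpM2l ?exprn_ge0 //.
  rewrite [leRHS](bigID (fun S : {ffun 'I_k -> U} => S i0 \in C)) /=.
  rewrite -[leLHS]addr0 lerD ?sumr_ge0 //.
  rewrite [leRHS](partition_big (fun S : {ffun 'I_k -> U} => S i0) (mem C)) /=;
    last by move=> S /andP[].
  apply: ler_sum => a aC; rewrite le_eqVlt; apply/orP; left; apply/eqP.
  apply: eq_bigl => S; rewrite consE; case: eqP => [->|]; last by rewrite !andbF.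
  by rewrite aC !andbT.
rewrite negb_exists => /forallP nq.
have fE : filled (q |: D) = filled D.
  apply/setP => i; rewrite !inE; move: (nq i); case: (s i) => // x.
  by rewrite !inE (inj_eq Some_inj) => /negPf ->.
rewrite (eq_bigr (fun=> potential D f)) => [|a _].
  by rewrite sumr_const -[leLHS]mulr_natl.
rewrite /potential fE; congr (_ * _); apply: eq_bigl => S.
rewrite /consistent; congr (_ && _); apply: eq_forallb => i.
move: (nq i); case: (s i) => // x; rewrite !inE (inj_eq Some_inj) => nx.
by rewrite (negPf nx) /assign (negPf nx).
Qed.

Lemma potential_set0 (f : Q -> U) :
  potential set0 f = \sum_(S | S \in ffun_on A) h S.
Proof.
rewrite /potential (_ : filled set0 = set0) ?cards0 ?expr0 ?mul1r.
  apply: eq_bigl => S; rewrite /consistent andb_idr // => _.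
  by apply/forallP => i; case: (s i) => // q; rewrite inE.
by apply/setP => i; rewrite !inE; case: (s i) => // q; rewrite inE.
Qed.

(** Unfilled slots range over all of [A], so there are [#|A| ^ (k - #|filled|)] consistent tuples,
    each of value at least [c]; halving [#|A|] in that power makes the bound independent of the
    number of filled slots. *)
Lemma potential_setT (f : Q -> U) (c : R) :
  (forall q, f q \in A) ->
  (forall S : {ffun 'I_k -> U}, (forall i q, s i = Some q -> S i = f q) ->
     c <= h S) ->
  0 <= c -> c * (#|A|%:R / 2) ^+ k <= potential [set: Q] f.
Proof.
move=> fA hc c0; rewrite /potential.
pose F (i : 'I_k) := if s i is Some q then [set f q] else A.
have consE : consistent [set: Q] f =i family F.
  move=> S; apply/andP/familyP => [[/ffun_onP SA /forallP H] i|H].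
    by move: (H i) (SA i); rewrite /F; case: (s i) => [q|//]; rewrite !inE /= => ->.
  split; first apply/ffun_onP => i; last apply/forallP => i;
    move: (H i); rewrite /F; case: (s i) => [q|//]; rewrite !inE //.
  by move=> /eqP ->.
have fk : (#|filled setT| <= k)%N by rewrite -[leqRHS](card_ord k) max_card.
have cardF : #|family F| = (#|A| ^ (k - #|filled [set: Q]|))%N.
  rewrite card_family foldrE big_map big_enum /=.
  rewrite (bigID (mem (filled setT))) /= big1 ?mul1n => [|i]; last first.
    by rewrite !inE /F; case: (s i) => // q _; rewrite cards1.
  rewrite (eq_bigr (fun=> #|A|)) => [|i]; last first.
    by rewrite !inE /F; case: (s i) => // q; rewrite inE.
  rewrite prod_nat_const; congr (_ ^ _)%N.
  transitivity #|~: filled setT|; first by apply: eq_card => i; rewrite in_setC.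
  by apply/eqP; rewrite -(eqn_add2l #|filled setT|) cardsC card_ord subnKC.
set X := #|A|%:R / 2; have X0 : 0 <= X by rewrite divr_ge0 ?ler0n.
rewrite -[in X ^+ k](subnKC fk) exprD mulrCA ler_wpM2l ?exprn_ge0 //.
apply: (@le_trans _ _ (\sum_(S | consistent setT f S) c)); last first.
  apply: ler_sum => S /andP[_ /forallP H]; apply: hc => i q si.
  by move: (H i); rewrite si inE => /eqP.
rewrite sumr_const (eq_card consE) cardF -[leRHS]mulr_natr ler_wpM2l // natrX.
rewrite lerXn2r ?nnegrE ?ler0n // /X; have := ler0n R #|A|; lra.
Qed.

End Slots.

(* The vertices of [Q] are placed one at a time, each on an unused vertex of
   [A] chosen so that the total potential does not increase. *)
Lemma injective_embedding (P : finType) (B : pred P)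
    (s : P -> 'I_k -> option Q) (h : {ffun 'I_k -> U} -> R) :
  (forall p i j q, s p i = Some q -> s p j = Some q -> i = j) ->
  (forall S, 0 <= h S) ->
  (0 < #|A|)%N -> (#|Q|.*2 <= #|A|)%N ->
  exists f : Q -> U, [/\ injective f, forall q, f q \in A &
    \sum_(p | B p) potential (s p) h [set: Q] f
      <= #|B|%:R * \sum_(S | S \in ffun_on A) h S].
Proof.
move=> s_inj h0 /card_gt0P[u0 u0A] QA.
set Y := \sum_(S | _) _.
(* Induction on the number of placed vertices; the values of [f] outside [D] are arbitrary. *)
suff H j : (j <= #|Q|)%N -> exists D : {set Q}, exists f : Q -> U,
    [/\ #|D| = j, {in D &, injective f}, {in D, forall q, f q \in A} &
     \sum_(p | B p) potential (s p) h D f <= #|B|%:R * Y].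
  have [D [f [cD finj fA hf]]] := H _ (leqnn _).
  have DT : D = setT by apply/eqP; rewrite eqEcard subsetT cardsT cD leqnn.
  exists f; rewrite -DT; split=> // [q q'|q]; [apply: finj | apply: fA];
    by rewrite DT inE.
elim: j => [|j IHj] jQ.
  exists set0, (fun=> u0); split=> [|q q'|q|]; rewrite ?cards0 ?inE //.
  under eq_bigr => p _ do rewrite potential_set0.
  by rewrite sumr_const -[leLHS]mulr_natl.
have [D [f [cD finj fA hf]]] := IHj (ltnW jQ).
have [q qD] : exists q, q \notin D.
  apply/existsP; rewrite -negb_forall; apply/negP => /forallP DT.
  suff DE : D = setT by move: jQ; rewrite -cD DE cardsT ltnn.
  by apply/setP => x; rewrite DT inE.
pose C := A :\: f @: D.
have CA : C \subset A by rewrite subsetDl.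
have hC : (#|A| <= #|C|.*2)%N.
  rewrite /C cardsD; have := leq_imset_card f D.
  have := subset_leq_card (subsetIr A (f @: D)); lia.
have hCR : #|A|%:R / 2 <= #|C|%:R :> R.
  by rewrite ler_pdivrMr // -natrM ler_nat muln2.
have C0 : exists a, a \in C.
  apply/card_gt0P; have : (0 < #|A|)%N by apply/card_gt0P; exists u0.
  lia.
(* Averaged over the free elements [C], the total potential does not exceed its present value. *)
have [a aC ha] : exists2 a, a \in C &
    \sum_(p | B p) potential (s p) h (q |: D) (assign f q a)
      <= \sum_(p | B p) potential (s p) h D f.
  apply: exists_le_of_sum => //.
  rewrite exchange_big /= sumr_const -[leRHS]mulr_natl mulr_sumr.
  apply: ler_sum => p _; apply: potential_assign => //; exact: s_inj.
move: aC; rewrite inE => /andP[afD aA].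
exists (q |: D), (assign f q a); split; last exact: le_trans hf.
- by rewrite cardsU1 qD cD.
- move=> x y; rewrite !inE /assign.
  case: eqP => [->|/eqP xq] /=; case: eqP => [->|/eqP yq] //= xD yD.
  + by move=> E; case/negP: afD; rewrite E imset_f.
  + by move=> E; case/negP: afD; rewrite -E imset_f.
  + exact: finj.
- move=> x; rewrite !inE /assign; case: eqP => //= _; exact: fA.
Qed.

End InjectiveEmbedding.

(** * Assembly of the embedding for bipartite relations *)

(** Double counting of [r]: each counted [p] is in at least one pair, each [q] in at most
    [Delta]. *)
Lemma card_nonisolated (P Q : finType) (r : P -> Q -> bool) (Delta : nat) :
  (forall q, (#|[set p | r p q]| <= Delta)%N) ->
  (#|[pred p | [exists q, r p q]]| <= Delta * #|Q|)%N.
Proof.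
move=> hD; rewrite -sum1_card.
apply: (@leq_trans (\sum_p \sum_q r p q)).
  rewrite big_mkcond /=; apply: leq_sum => p _; rewrite inE.
  by case: existsP => // -[q rpq]; rewrite (bigD1 q) //= rpq.
rewrite exchange_big /= mulnC -sum_nat_const; apply: leq_sum => q _.
apply: leq_trans (hD q); rewrite -sum1_card [leqRHS]big_mkcond /= leq_sum // => p _.
by rewrite inE; case: (r p q).
Qed.

(** [Q] is placed in the set [A] of the dependent random choice, then [P] greedily in [W]. The
    parameter [t] stands for the root [Delta^(1/(m+1))], so that an ordered field suffices. *)
Lemma bipartite_embedding (R : realFieldType) (P Q U W : finType)
    (r : P -> Q -> bool) (e : U -> W -> bool) (m n Delta : nat) (eps t : R) :
  (0 < n)%N -> #|P| + #|Q| = n ->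
  (forall p, #|[set q | r p q]| <= m.+1)%N ->
  (forall q, #|[set p | r p q]| <= Delta)%N ->
  0 < eps -> eps <= 1 -> 1 <= t -> t ^+ m.+1 = Delta%:R ->
  eps * (#|U|%:R * #|W|%:R) <= (\sum_u #|[set w | e u w]|)%:R ->
  16 * t * n%:R <= eps ^+ m.+1 * #|U|%:R ->
  16 * t * n%:R <= eps ^+ m.+1 * #|W|%:R ->
  exists f : Q -> U, exists g : P -> W,
    [/\ injective f, injective g & forall p q, r p q -> e (f q) (g p)].
Proof.
move=> n0 cPQ hk hDelta e0 e1 t1 tk he hU hW.
have nR : 0 < n%:R :> R by rewrite ltr0n.
have tn0 : n%:R <= t * n%:R by rewrite ler_peMl // ltW.
have sizeW (Z : finType) : 16 * t * n%:R <= eps ^+ m.+1 * #|Z|%:R -> (n <= #|Z|)%N.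
  move=> hZ; rewrite -(ler_nat R).
  have : eps ^+ m.+1 * #|Z|%:R <= #|Z|%:R.
    by rewrite ler_piMl ?ler0n // exprn_ile1 // ltW.
  lra.
have nW := sizeW _ hW; have nU := sizeW _ hU.
have [A [hA hY]] := dependent_random_choice m n0 (leq_trans n0 nU)
  (leq_trans n0 nW) e0 he.
set Y := (X in X * _ <= _) in hY.
have Y0 : 0 <= Y by rewrite sumr_ge0 // => S _; exact: scarcity_ge0.
set X : R := #|A|%:R in hA hY.
(* One factor 2 of the constant 16, raised to the power [m.+1], pays for the 2 in [hA]. *)
have hX : 8 * n%:R <= X.
  rewrite -(@ler_pXn2r _ m.+1) ?nnegrE ?mulr_ge0 ?ler0n //.
  have h1 : (16 * n%:R) ^+ m.+1 <= (eps ^+ m.+1 * #|U|%:R) ^+ m.+1.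
    rewrite lerXn2r ?nnegrE ?mulr_ge0 ?exprn_ge0 ?ler0n ?(ltW e0) //; lra.
  have h2 : 2 * (8 * n%:R) ^+ m.+1 <= (16 * n%:R) ^+ m.+1 :> R.
    have -> : 16 * n%:R = 2 * (8 * n%:R) :> R by ring.
    rewrite [leRHS]exprMn ler_wpM2r ?exprn_ge0 ?mulr_ge0 ?ler0n //.
    by rewrite exprS ler_peMr // exprn_ege1 // ler1n.
  lra.
have X0 : 0 < X by lra.
have A0 : (0 < #|A|)%N by rewrite -(ltr_nat R).
have QA : (#|Q|.*2 <= #|A|)%N.
  have : (8 * n <= #|A|)%N by rewrite -(ler_nat R) natrM.
  lia.
(* [onth] gives [None] beyond the degree of [p]; by [hk] no neighbour is cut off. *)
pose s p (i : 'I_m.+1) := onth (enum [set q | r p q]) i.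
have s_inj p i j q : s p i = Some q -> s p j = Some q -> i = j.
  rewrite /s => si sj; apply: val_inj; apply: (onth_inj _ _ _ (enum_uniq [set q | r p q])).
    by rewrite gtn_min -!onthTE si sj.
  by rewrite si sj.
have [f [finj fA hf]] := injective_embedding [pred p | [exists q, r p q]] s_inj
  (fun S : {ffun _ -> _} => scarcity_ge0 R n #|common_nbhd e S|) A0 QA.
pose N p := [set w | [forall q, r p q ==> e (f q) w]].
(* A tuple [S] agreeing with [f] on the filled slots has its common neighbourhood inside [N p],
   hence at least the scarcity of [N p]. *)
have hN p : [exists q, r p q] -> scarcity R n #|N p| * (X / 2) ^+ m.+1 <=
    potential A (s p) (fun S => scarcity R n #|common_nbhd e S|) [set: Q] f.
  move=> _; apply: potential_setT => //; last exact: scarcity_ge0.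
  move=> S hS; apply: scarcity_antitone; apply: subset_leq_card.
  apply/subsetP => w; rewrite !inE => /forallP H; apply/forallP => q.
  apply/implyP => rpq.
  have /onthP[i si] : q \in enum [set q | r p q] by rewrite mem_enum inE.
  have ik : (i < m.+1)%N.
    by apply: leq_trans (hk p); rewrite cardE -onthTE si.
  by rewrite -(hS (Ordinal ik)).
(* For isolated [p], [N p] is all of [W], of size at least [n], and the weight is 0. *)
have sumE : \sum_p scarcity R n #|N p|
    = \sum_(p | [exists q, r p q]) scarcity R n #|N p|.
  rewrite (bigID (fun p => [exists q, r p q])) /= [X in _ + X]big1 ?addr0 //.
  move=> p; rewrite negb_exists => /forallP np.
  have -> : N p = setT.
    by apply/setP => w; rewrite !inE; apply/forallP => q; rewrite (negPf (np q)).
  by rewrite cardsT /scarcity ltnNge nW.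
have hYn : Y * (16 ^+ m.+1 * Delta%:R * n%:R) <= 2 * X ^+ m.+1.
  have nm : 0 < n%:R ^+ m :> R by rewrite exprn_gt0.
  rewrite -(ler_pM2r nm).
  have -> : 2 * X ^+ m.+1 * n%:R ^+ m = 2 * n%:R ^+ m * X ^+ m.+1 by ring.
  apply: le_trans hY.
  have -> : Y * (16 ^+ m.+1 * Delta%:R * n%:R) * n%:R ^+ m
      = Y * (16 * t * n%:R) ^+ m.+1.
    by rewrite !exprMn tk (exprS n%:R m); ring.
  rewrite ler_wpM2l // lerXn2r ?nnegrE //; lra.
have cB : #|[pred p | [exists q, r p q]]|%:R <= Delta%:R * n%:R :> R.
  rewrite -natrM ler_nat (leq_trans (card_nonisolated hDelta)) // leq_mul2l.
  by rewrite -cPQ leq_addl orbT.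
(* With [k = m.+1], the sum times [(X / 2)^k] is at most [Delta * n * Y <= 2 * X^k / 16^k], so the
   sum is at most [2 / 8^k < 1]. *)
have small : \sum_p scarcity R n #|N p| < 1.
  have Xk : 0 < (X / 2) ^+ m.+1 by rewrite exprn_gt0 // divr_gt0.
  rewrite -(ltr_pM2r Xk) mul1r sumE mulr_suml.
  apply: (@le_lt_trans _ _ (Delta%:R * n%:R * Y)).
    apply: (le_trans (ler_sum _ hN)); apply: (le_trans hf).
    by rewrite ler_wpM2r.
  have p16 : 0 < 16 ^+ m.+1 :> R by rewrite exprn_gt0.
  rewrite -(ltr_pM2r p16).
  have -> : Delta%:R * n%:R * Y * 16 ^+ m.+1
    = Y * (16 ^+ m.+1 * Delta%:R * n%:R) by ring.
  apply: le_lt_trans hYn _; rewrite -exprMn.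
  have -> : X / 2 * 16 = 8 * X by field.
  rewrite exprMn ltr_pM2r ?exprn_gt0 // exprS.
  have : 1 <= 8 ^+ m :> R by rewrite exprn_ege1 // ler1n.
  lra.
have Pn : (#|P| <= n)%N by rewrite -cPQ leq_addr.
have [g [ginj gN]] := greedy_sdr Pn (leq_trans n0 nW) small.
exists f, g; split=> // p q rpq.
by move: (gN p); rewrite inE => /forallP/(_ q); rewrite rpq.
Qed.

(** * Passage from graphs to bipartite relations *)

Theorem theorem4p7 (R : realType) (n k Delta : nat) (eps : R)
    (H : sgraph) (H1 H2 : {set H}) (G : sgraph) (A B : {set G}) :
  (1 <= k)%N -> (1 <= Delta)%N -> 0 < eps ->
  bipartition H1 H2 ->
  #|H| = n ->
  (forall x : H, x \in H1 -> (degree x <= k)%N) ->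
  (forall x : H, x \in H2 -> (degree x <= Delta)%N) ->
  bipartition A B ->
  edge_density R A B = eps ->
  16%:R * (Delta%:R `^ (k%:R^-1)) * eps ^- k * n%:R <= #|A|%:R ->
  16%:R * (Delta%:R `^ (k%:R^-1)) * eps ^- k * n%:R <= #|B|%:R ->
  is_subgraph H G.
Proof.
case: k => // m _ D1 e0 [H12 dH i1 i2] cH dk dD [_ dG _ _] dens hA hB.
(* With an empty part the density divides by 0 and so equals 0, against [e0]. *)
have A0 : (0 < #|A|)%N.
  rewrite lt0n; apply/eqP => A0; move: e0.
  by rewrite -dens /edge_density A0 mul0r invr0 mulr0 ltxx.
have B0 : (0 < #|B|)%N.
  rewrite lt0n; apply/eqP => B0; move: e0.
  by rewrite -dens /edge_density B0 mulr0 invr0 mulr0 ltxx.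
have [x0 _] := card_gt0P A0.
have [n0|n0] := posnP n.
  have noH (x : H) : False.
    by have := card0_eq (etrans cH n0) x; rewrite inE.
  by exists (fun=> x0); split=> x; case: (noH x).
have AB0 : 0 < #|A|%:R * #|B|%:R :> R by rewrite mulr_gt0 ?ltr0n.
have e1 : eps <= 1.
  rewrite -dens /edge_density ler_pdivrMr // mul1r -natrM ler_nat -cardsX.
  by apply: subset_leq_card; apply/subsetP => z; rewrite !inE => /and3P[-> ->].
pose t : R := Delta%:R `^ (m.+1%:R^-1).
have tk : t ^+ m.+1 = Delta%:R.
  by rewrite -powR_mulrn ?powR_ge0 // -powRrM mulVf ?pnatr_eq0 // powRr1 ?ler0n.
have t1 : 1 <= t.
  by rewrite -(@ler_pXn2r _ m.+1) ?nnegrE ?powR_ge0 // expr1n tk ler1n.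
(* [H1], with degrees at most [m.+1], will go to [B], and [H2] to [A]. *)
pose P := {x : H | x \in H1}; pose Q := {x : H | x \in H2}.
pose U := {x : G | x \in A}; pose W := {x : G | x \in B}.
pose r (p : P) (q : Q) := adj (val p) (val q).
pose e (u : U) (w : W) := adj (val u) (val w).
have cU : #|{: U}| = #|A| by rewrite card_sig.
have cW : #|{: W}| = #|B| by rewrite card_sig.
have cPQ : (#|{: P}| + #|{: Q}| = n)%N.
  rewrite !card_sig -cH -cardsT -H12 cardsU.
  by move: dH; rewrite -setI_eq0 => /eqP ->; rewrite cards0 subn0.
have hP p : (#|[set q | r p q]| <= m.+1)%N.
  apply: leq_trans (dk _ (valP p)); rewrite /degree -(card_imset _ val_inj).
  apply: subset_leq_card; apply/subsetP => _ /imsetP[q rq ->].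
  by rewrite inE in rq; rewrite inE.
have hQ q : (#|[set p | r p q]| <= Delta)%N.
  apply: leq_trans (dD _ (valP q)); rewrite /degree -(card_imset _ val_inj).
  apply: subset_leq_card; apply/subsetP => _ /imsetP[p rq ->].
  by rewrite inE in rq; rewrite inE adj_sym.
have he : eps * (#|{: U}|%:R * #|{: W}|%:R) <= (\sum_u #|[set w | e u w]|)%:R.
  rewrite cU cW -dens /edge_density divfK ?gt_eqF // ler_nat.
  have -> : (\sum_u #|[set w | e u w]| = #|[set z : U * W | e z.1 z.2]|)%N.
    rewrite -sum1_card.
    rewrite (eq_bigl (fun z : U * W => xpredT z.1 && e z.1 z.2)); last first.
      by move=> z; rewrite inE.
    rewrite -(pair_big_dep xpredT e (fun _ _ => 1%N)) /=; apply: eq_bigr => u _.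
    by rewrite -sum1_card; apply: eq_bigl => w; rewrite inE.
  pose vv (z : U * W) := (val z.1, val z.2).
  apply: leq_trans (leq_imset_card vv _); apply: subset_leq_card.
  apply/subsetP => -[x y]; rewrite inE /= => /and3P[xA yB xy].
  by apply/imsetP; exists (exist _ x xA, exist _ y yB); rewrite ?inE.
have scale (c : nat) : 16 * t * eps ^- m.+1 * n%:R <= c%:R ->
    16 * t * n%:R <= eps ^+ m.+1 * c%:R.
  move=> h; have ek : 0 < eps ^+ m.+1 by rewrite exprn_gt0.
  by rewrite [leRHS]mulrC -ler_pdivrMr // mulrAC.
have [f [g [finj ginj hfg]]] : exists f : Q -> U, exists g : P -> W,
    [/\ injective f, injective g & forall p q, r p q -> e (f q) (g p)].
  apply: (bipartite_embedding n0 cPQ hP hQ e0 e1 t1 tk he).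
    by rewrite cU; apply: scale.
  by rewrite cW; apply: scale.
(* The default [x0] is never reached, since [H1] and [H2] cover [H]. *)
pose F x : G := if insub x is Some p then val (g p)
  else if insub x is Some q then val (f q) else x0.
have F1 p : F (val p) = val (g p) by rewrite /F valK.
have F2 q : F (val q) = val (f q).
  rewrite /F valK insubN //; apply/negP => q1.
  by have := disjointFr dH q1; rewrite (valP q).
have cases x : (exists p : P, x = val p) \/ (exists q : Q, x = val q).
  have : x \in H1 :|: H2 by rewrite H12 inE.
  by rewrite inE => /orP[h|h]; [left|right]; exists (exist _ x h).
have fg p q : val (f q) != val (g p).
  by apply/eqP => E; have := disjointFr dG (valP (f q)); rewrite E (valP (g p)).
exists F; split=> x y.
  case: (cases x) (cases y) => [[p ->]|[q ->]] [[p' ->]|[q' ->]].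
  - by rewrite !F1 => /val_inj/ginj ->.
  - by rewrite F1 F2 => /esym/eqP; rewrite (negPf (fg _ _)).
  - by rewrite F1 F2 => /eqP; rewrite (negPf (fg _ _)).
  - by rewrite !F2 => /val_inj/finj ->.
(* Edges of [H] inside one part are excluded by independence; the other two cases differ by symmetry
   of [adj]. *)
case: (cases x) (cases y) => [[p ->]|[q ->]] [[p' ->]|[q' ->]] h.
- by move: (i1 _ _ (valP p) (valP p')); rewrite h.
- by rewrite F1 F2 adj_sym; apply: hfg.
- by rewrite F1 F2; apply: hfg; rewrite /r adj_sym.
- by move: (i2 _ _ (valP q) (valP q')); rewrite h.
Qed.
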